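(* Let $\tilde M(\mathbf q)\in\mathbb R^{N\times n}$ and $\tilde{\mathbf f}(\mathbf q)\in\mathbb R^N$ be the C-RONS (collocation) matrix and vector, and let $\bar M(\mathbf q)\in\mathbb R^{n\times n}$ and $\bar{\mathbf f}(\mathbf q)\in\mathbb R^n$ be the Monte Carlo approximations of the metric tensor and right-hand side vector built from the same points $\mathbf x_1,\dots,\mathbf x_N\in D$. If the C-RONS matrix $\tilde M(\mathbf q)$ has full column rank, then the Monte Carlo approximation of RONS, $$\bar M(\mathbf q)\,\dot{\mathbf q}=\bar{\mathbf f}(\mathbf q),$$ is equivalent to the C-RONS equation $$\dot{\mathbf q}=\tilde M^{+}(\mathbf q)\,\tilde{\mathbf f}(\mathbf q),$$ where $\tilde M^{+}$ denotes the Moore–Penrose pseudoinverse of $\tilde M$; that is, a vector $\dot{\mathbf q}\in\mathbb R^n$ satisfies one of these equations if and only if it satisfies the other.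
   Context: Setting: $D\subset\mathbb R^d$ is a bounded spatial domain of size (volume) $|D|$, with $0<|D|<\infty$. $F$ is a (possibly nonlinear) differential operator, the right-hand side of the PDE $\partial u/\partial t=F(u)$ with real-valued $u$. $\hat u(\mathbf x,\mathbf q)\in\mathbb R$ is an approximate solution depending differentiably on parameters $\mathbf q=(q_1,\dots,q_n)\in\mathbb R^n$. Points $\mathbf x_1,\dots,\mathbf x_N\in D$ are given, serving both as the collocation points and as the Monte Carlo samples; $\partial\hat u/\partial q_j$ and $F(\hat u)$ can be evaluated pointwise at them. C-RONS matrix and vector: $$\tilde M_{ij}(\mathbf q)=\frac{\partial\hat u}{\partial q_j}(\mathbf x_i,\mathbf q),\qquad \tilde f_i(\mathbf q)=F(\hat u(\cdot,\mathbf q))\big|_{\mathbf x=\mathbf x_i},\qquad i\in\{1,\dots,N\},\ j\in\{1,\dots,n\}.$$ Monte Carlo approximations (of $M_{ij}=\langle\partial_{q_i}\hat u,\partial_{q_j}\hat u\rangle_{L^2(D)}$ and $f_i=\langle\partial_{q_i}\hat u,F(\hat u)\rangle_{L^2(D)}$): $$\bar M_{ij}(\mathbf q)=\frac{|D|}{N}\sum_{k=1}^N\frac{\partial\hat u}{\partial q_i}(\mathbf x_k,\mathbf q)\,\frac{\partial\hat u}{\partial q_j}(\mathbf x_k,\mathbf q),\qquad \bar f_i(\mathbf q)=\frac{|D|}{N}\sum_{k=1}^N\frac{\partial\hat u}{\partial q_i}(\mathbf x_k,\mathbf q)\,F(\hat u)\big|_{\mathbf x=\mathbf x_k},\qquad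 i,j\in\{1,\dots,n\}.$$ *)

(* Defs.v *)
From HB Require Import structures.
From mathcomp Require Import all_boot all_order all_algebra.
From mathcomp Require Import all_classical all_reals all_analysis.
Import Order.TTheory GRing.Theory Num.Theory.
Import numFieldNormedType.Exports.

Set Implicit Arguments.
Unset Strict Implicit.
Unset Printing Implicit Defensive.

Local Open Scope classical_set_scope.
Local Open Scope ring_scope.

Section Volume.
Variables (R : realType) (d : nat).
Implicit Types (a b : 'cV[R]_d) (A : set 'cV[R]_d).

Definition box a b : set 'cV[R]_d :=
  [set x | forall i, a i 0 <= x i 0 <= b i 0].

(* The volume of [box a b], provided a <= b coordinatewise. *)
Definition box_volume a b : R := \prod_i (b i 0 - a i 0).

Definition box_cover A (ab : nat -> 'cV[R]_d * 'cV[R]_d) : Prop :=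
  (forall k i, (ab k).1 i 0 <= (ab k).2 i 0) /\
  A `<=` \bigcup_k box (ab k).1 (ab k).2.

(* Lebesgue outer measure on R^d. It is the d-dimensional volume on the sets
   in lebesgue_outer.-caratheodory (the Lebesgue measurable sets). For d = 0
   every box has volume 1 and the formula is not meaningful. *)
Definition lebesgue_outer A : \bar R :=
  ereal_inf [set (\sum_(0 <= k <oo) (box_volume (ab k).1 (ab k).2)%:E)%E
            | ab in box_cover A].

Definition volume A : R := fine (lebesgue_outer A).

End Volume.

Section DifferentialOperator.
Variables (R : realType) (d : nat).
Implicit Types (u : 'cV[R]_d -> R) (x : 'cV[R]_d) (s : seq 'I_d).

(* The iterated partial derivative of u along the coordinates listed in s,
   the last one first. *)
Fixpoint partials s u : 'cV[R]_d -> R :=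
  if s is i :: s' then 'D_(delta_mx i 0) (partials s' u) else u.

(* All partial derivatives of u of order at most m exist at x; those of order
   less than m have to exist around x for this to make sense. *)
Definition has_partials m u x : Prop :=
  (forall s i, (size s < m)%N ->
     derivable (partials s u) x (delta_mx i 0)) /\
  (forall s i, (size s < m.-1)%N ->
     \forall y \near x, derivable (partials s u) y (delta_mx i 0)).

Definition jet m u x (t : {bseq m of 'I_d}) : R := partials t u x.

(* F is a (possibly nonlinear) partial differential operator of order at most m
   on D. Nothing is required of F u at points where u lacks the derivatives. *)
Definition differential_operator (D : set 'cV[R]_d) m
    (F : ('cV[R]_d -> R) -> 'cV[R]_d -> R) : Prop :=
  exists G : 'cV[R]_d -> ({bseq m of 'I_d} -> R) -> R,
    forall u x, D x -> has_partials m u x -> F u x = G x (jet u x).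

End DifferentialOperator.

Section MoorePenrose.
Variables (R : realType) (p r : nat).
Implicit Types (A : 'M[R]_(p, r)) (P : 'M[R]_(r, p)).

(* The four Penrose equations. *)
Definition moore_penrose A P : Prop :=
  [/\ A *m P *m A = A, P *m A *m P = P,
      (A *m P)^T = A *m P & (P *m A)^T = P *m A].

(* The Penrose equations have exactly one solution, so the default value is
   never used. Not to be confused with the library's pinvmx, which is only a
   generalized inverse. *)
Definition mp_pinv A : 'M[R]_(r, p) := xget 0 (moore_penrose A).

End MoorePenrose.

Section RONS.
Variables (R : realType) (d n N : nat).
Variables (D : set 'cV[R]_d) (F : ('cV[R]_d -> R) -> 'cV[R]_d -> R).
Variables (u : 'cV[R]_d -> 'cV[R]_n -> R) (x : 'I_N -> 'cV[R]_d).
Implicit Type q : 'cV[R]_n.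

Definition dparam (j : 'I_n) (y : 'cV[R]_d) q : R :=
  'D_(delta_mx j 0) (u y) q.

Definition F_ansatz (y : 'cV[R]_d) q : R := F (u ^~ q) y.

Definition crons_mx q : 'M[R]_(N, n) := \matrix_(i, j) dparam j (x i) q.

Definition crons_rhs q : 'cV[R]_N := \col_i F_ansatz (x i) q.

Definition mc_mx q : 'M[R]_n :=
  \matrix_(i, j) (volume D / N%:R *
                  \sum_(k < N) dparam i (x k) q * dparam j (x k) q).

Definition mc_rhs q : 'cV[R]_n :=
  \col_i (volume D / N%:R * \sum_(k < N) dparam i (x k) q * F_ansatz (x k) q).

End RONS.

(* Main.v *)
Require Import Defs.
From HB Require Import structures.
From mathcomp Require Import all_boot all_order all_algebra.
From mathcomp Require Import all_classical all_reals all_analysis.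
Import Order.TTheory GRing.Theory Num.Theory.
Import numFieldNormedType.Exports.

Local Open Scope classical_set_scope.
Local Open Scope ring_scope.

(** Write A for the collocation matrix, b for the collocation right-hand side
and c = |D| / N. The Monte Carlo sums run over the very points that index the
rows of A, so the Monte Carlo system is c (A^T A) qdot = c A^T b: up to the
factor c, it is the system of normal equations of the least-squares problem
A qdot = b ([mc_mxE], [mc_rhsE]). When N > 0 the factor is nonzero because D
has positive finite volume, and it cancels.

Over an ordered field, v A^T A v^T is a sum of squares, so A^T A is invertible
as soon as A has full column rank ([gram_unitmx]), and the normal equations
have a unique solution. The vector A^+ b is that solution: two of the Penrose
equations already give A^T A A^+ = A^T ([gram_mul_moore_penrose]). Since A^+ is
selected by choice, one also has to exhibit a matrix satisfying the Penrose
equations, namely (A^T A)^-1 A^T ([moore_penrose_full_rank]). *)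

Lemma mulmx_tr_eq0 {R : realDomainType} {k p : nat} {B : 'M[R]_(k, p)} :
  B *m B^T = 0 -> B = 0.
Proof.
move=> BBT0; apply/matrixP => i j; rewrite [RHS]mxE.
(* The diagonal entries of B B^T are the sums of squares of the rows of B. *)
move/matrixP/(_ i i): BBT0; rewrite !mxE => /eqP.
rewrite psumr_eq0 => [/allP/(_ j (mem_index_enum _))|l _]; rewrite !mxE.
  by rewrite /= mulf_eq0 orbb => /eqP.
by rewrite -expr2 sqr_ge0.
Qed.

(** If v A^T A = 0 then (v A^T)(v A^T)^T = 0, so v A^T = 0, and v = 0 because
the rows of A^T are independent. *)
Lemma gram_unitmx {R : realFieldType} {p r : nat} {A : 'M[R]_(p, r)} :
  \rank A = r -> A^T *m A \in unitmx.
Proof.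
move=> rkA; rewrite -row_free_unit -kermx_eq0; apply/eqP.
have ATfree : row_free A^T by rewrite /row_free mxrank_tr rkA.
have kerAT0 : kermx (A^T *m A) *m A^T = 0.
  apply: mulmx_tr_eq0.
  by rewrite trmx_mul trmxK mulmxA -(mulmxA _ A^T) mulmx_ker mul0mx.
by apply: (row_free_inj ATfree); rewrite kerAT0 mul0mx.
Qed.

Section MoorePenroseFullRank.
Context {R : realType} {p r : nat}.
Implicit Types (A : 'M[R]_(p, r)) (P : 'M[R]_(r, p)).

(** A P is the orthogonal projection onto the column space of A, so it is
absorbed by A^T: A^T A P = A^T (A P)^T = (A P A)^T = A^T. *)
Lemma gram_mul_moore_penrose {A P} : moore_penrose A P -> A^T *m A *m P = A^T.
Proof. by case=> APA _ APsym _; rewrite -mulmxA -APsym -trmx_mul APA. Qed.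

Lemma moore_penrose_full_rank {A} :
  \rank A = r -> moore_penrose A (invmx (A^T *m A) *m A^T).
Proof.
move=> /gram_unitmx Gunit.
have PA1 : invmx (A^T *m A) *m A^T *m A = 1%:M by rewrite -mulmxA mulVmx.
split.
- by rewrite -mulmxA PA1 mulmx1.
- by rewrite PA1 mul1mx.
- by rewrite !trmx_mul trmxK trmx_inv trmx_mul trmxK mulmxA.
- by rewrite PA1 trmx1.
Qed.

Lemma mp_pinv_full_rank {A} : \rank A = r -> moore_penrose A (mp_pinv A).
Proof.
by move=> rkA; apply: xgetPex; exists (invmx (A^T *m A) *m A^T);
  exact: moore_penrose_full_rank.
Qed.

Lemma normal_equations_pinv A (b : 'cV[R]_p) (v : 'cV[R]_r) :
  \rank A = r -> A^T *m A *m v = A^T *m b <-> v = mp_pinv A *m b.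
Proof.
move=> rkA; have GP := gram_mul_moore_penrose (mp_pinv_full_rank rkA).
split=> [|->]; last by rewrite mulmxA GP.
rewrite -{2}GP -[_ *m mp_pinv A *m b]mulmxA.
by move/(congr1 (mulmx (invmx (A^T *m A)))); rewrite !mulKmx ?gram_unitmx.
Qed.

End MoorePenroseFullRank.

Section MonteCarlo.
Context {R : realType} {d n N : nat}.
Variables (D : set 'cV[R]_d) (F : ('cV[R]_d -> R) -> 'cV[R]_d -> R).
Variables (u : 'cV[R]_d -> 'cV[R]_n -> R) (x : 'I_N -> 'cV[R]_d).
Implicit Type q : 'cV[R]_n.

Lemma mc_mxE q : mc_mx D u x q =
  (volume D / N%:R) *: ((crons_mx u x q)^T *m crons_mx u x q).
Proof.
apply/matrixP => i j; rewrite !mxE; congr (_ * _).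
by apply: eq_bigr => k _; rewrite !mxE.
Qed.

Lemma mc_rhsE q : mc_rhs D F u x q =
  (volume D / N%:R) *: ((crons_mx u x q)^T *m crons_rhs F u x q).
Proof.
apply/matrixP => i j; rewrite !mxE; congr (_ * _).
by apply: eq_bigr => k _; rewrite !mxE.
Qed.

End MonteCarlo.

Theorem theorem2 (R : realType) (d n N m : nat) (d_gt0 : (0 < d)%N)
    (D : set 'cV[R]_d) (D_bounded : bounded_set D)
    (D_measurable : (@lebesgue_outer R d).-caratheodory D)
    (D_volume : (0 < lebesgue_outer D < +oo)%E)
    (F : ('cV[R]_d -> R) -> 'cV[R]_d -> R)
    (F_diffop : differential_operator D m F)
    (u : 'cV[R]_d -> 'cV[R]_n -> R)
    (u_diff : forall y q, D y -> differentiable (u y) q)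
    (x : 'I_N -> 'cV[R]_d) (x_in_D : forall k, D (x k))
    (q : 'cV[R]_n)
    (F_eval : forall k, has_partials m (fun y => u y q) (x k))
    (full_column_rank : \rank (crons_mx u x q) = n)
    (qdot : 'cV[R]_n) :
  mc_mx D u x q *m qdot = mc_rhs D F u x q <->
  qdot = mp_pinv (crons_mx u x q) *m crons_rhs F u x q.
Proof.
have [n0|n_gt0] := posnP n.
  (* For n = 0 all the vectors are empty; N = 0, which would make the factor
     |D| / N vanish, is possible only in this case. *)
  by split=> _; apply/matrixP => -[i i_lt]; exfalso; rewrite n0 in i_lt.
have N_gt0 : (0 < N)%N.
  by rewrite (leq_trans n_gt0)// -full_column_rank rank_leq_row.
have c_neq0 : volume D / N%:R != 0.
  by rewrite mulf_neq0 ?invr_eq0 ?pnatr_eq0 -?lt0n// gt_eqF ?fine_gt0.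
rewrite -normal_equations_pinv// mc_mxE mc_rhsE -scalemxAl.
by split=> [/(scalerI c_neq0)|->].
Qed.
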